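(* Let $(X,p,K)$ be a Hausdorff complete partial metric type space. Let $\alpha,\beta:X\times X\to[0,\infty)$ be mappings, let $C_\alpha>0$ and $C_\beta\ge 0$, and suppose that $f:X\to X$ is $(C_\alpha,C_\beta)$-admissible with respect to $K$. Assume that $$\alpha(x,y)\,p(fx,fy)\le\beta(x,y)\,p(x,y)\quad\text{for all }x,y\in X.$$ Suppose the following conditions hold: (i) $f$ is $p$-sequentially continuous; (ii) there exists $x_0\in X$ such that $\alpha(x_0,fx_0)\ge C_\alpha$ and $\beta(x_0,fx_0)\le C_\beta$. Then $f$ has a fixed point.
   Context: A partial metric type on a set $X$ is a function $p:X\times X\to[0,\infty)$ such that: (pm1) for all $x,y\in X$, $x=y$ iff $p(x,x)=p(x,y)=p(y,y)$; (pm2) $p(x,x)\le p(x,y)$ for all $x,y\in X$; (pm3) $p(x,y)=p(y,x)$ for all $x,y\in X$; (pm4) there is a real number $K\ge 1$ such that $p(x,y)+p(z_1,z_1)+\cdots+p(z_N,z_N)\le K[p(x,z_1)+p(z_1,z_2)+\cdots+p(z_N,y)]$ for any points $x,y,z_1,\dots,z_N\in X$, where $N\ge 1$ is a fixed natural number. The triplet $(X,p,K)$ is called a $K$-partial metric space ($K$-PMS), or partial metric type space. The topology $\tau_p$ on $X$ generated by $p$ is the one whose base is the family of open $p$-balls $B_p(x,\varepsilon)=\{y\in X:\ p(x,y)<\varepsilon+p(x,x)\}$, $x\in X$, $\varepsilon>0$; Hausdorff refers to this topology. A sequence $(x_n)$ in $X$ ($p$-)converges to $x\in X$, written $x_n\overset{p}{\longrightarrow}x$,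 if $\lim_{n\to\infty}p(x_n,x)=p(x,x)$. It is Cauchy if $\lim_{n,m\to\infty}p(x_n,x_m)$ exists and is finite. $(X,p,K)$ is complete if for every Cauchy sequence $(x_n)$ in $X$ there is $x\in X$ with $\lim_{n,m\to\infty}p(x_n,x_m)=\lim_{n\to\infty}p(x_n,x)=p(x,x)$. A map $f:X\to X$ is $p$-sequentially continuous if $x_n\overset{p}{\longrightarrow}x$ implies $fx_n\overset{p}{\longrightarrow}fx$. Given $\alpha,\beta:X\times X\to[0,\infty)$, $C_\alpha>0$ and $C_\beta\ge0$, a map $f:X\to X$ is $(C_\alpha,C_\beta)$-admissible with respect to $K$ if: (C1) for all $x,y\in X$, $\alpha(x,y)\ge C_\alpha$ implies $\alpha(fx,fy)\ge C_\alpha$; (C2) for all $x,y\in X$, $\beta(x,y)\le C_\beta$ implies $\beta(fx,fy)\le C_\beta$; (C3) $0\le C_\beta/C_\alpha<1/K$.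
   Formalization: The open p-balls need not form a base, and the claim fails for some spaces where they form a Hausdorff one; here a set is open in the topology generated by p when it contains a p-ball centred at each of its points, and Hausdorff refers to this topology. *)

(* Defs.v *)
From HB Require Import structures.
From mathcomp Require Import all_boot all_order all_algebra.
From mathcomp Require Import all_classical all_reals all_analysis.
Set Implicit Arguments.
Unset Strict Implicit.
Unset Printing Implicit Defensive.
Import Order.TTheory GRing.Theory Num.Theory numFieldNormedType.Exports.
Local Open Scope classical_set_scope.
Local Open Scope ring_scope.

(* In pm4, z = (z_1, ..., z_N) and [pairmap p x (rcons z y)] is the list
   p x z_1, p z_1 z_2, ..., p z_N y. *)
Record partial_metric_type (R : realType) (X : Type) (N : nat) (K : R)
    (p : X -> X -> R) : Prop := PartialMetricType {
  pm_ge0 : forall x y, 0 <= p x y ;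
  pm1 : forall x y, x = y <-> p x x = p x y /\ p x y = p y y ;
  pm2 : forall x y, p x x <= p x y ;
  pm3 : forall x y, p x y = p y x ;
  pm_N_ge1 : (1 <= N)%N ;
  pm_K_ge1 : 1 <= K ;
  pm4 : forall (x y : X) (z : N.-tuple X),
    p x y + \sum_(t <- z) p t t <= K * \sum_(d <- pairmap p x (rcons z y)) d
}.

Definition pm_ball (R : realType) (X : Type) (p : X -> X -> R)
  (x : X) (e : R) : set X := [set y | p x y < e + p x x].

(* U is open iff it contains a ball centred at each of its points.  For K > 1
   an arbitrary ball need not be open; when all balls are open, they form a
   base of this topology (pm_ball_base). *)
Definition pm_open (R : realType) (X : Type) (p : X -> X -> R) : set (set X) :=
  [set U | forall x, U x -> exists2 e : R, 0 < e & pm_ball p x e `<=` U].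

Lemma pm_ball_base (R : realType) (X : Type) (p : X -> X -> R) :
  (forall x (e : R), 0 < e -> pm_open p (pm_ball p x e)) ->
  forall U : set X, pm_open p U <->
    exists2 S : set (X * R), (forall s, S s -> 0 < s.2) &
      U = \bigcup_(s in S) pm_ball p s.1 s.2.
Proof.
move=> ballO U; split=> [oU|[S S0 ->] x [s Ss sx]].
  exists [set s | 0 < s.2 /\ pm_ball p s.1 s.2 `<=` U]; first by move=> s [].
  apply/seteqP; split=> [x Ux|x [s [_ sU]] /sU//].
  have [e e0 eU] := oU _ Ux; exists (x, e) => //.
  by rewrite /pm_ball /= ltrDr.
have [e e0 eS] := ballO _ _ (S0 _ Ss) _ sx.
by exists e => // y /eS ?; exists s.
Qed.

Lemma pm_openT (R : realType) (X : Type) (p : X -> X -> R) : pm_open p setT.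
Proof. by move=> x _; exists 1. Qed.

Lemma pm_openI (R : realType) (X : Type) (p : X -> X -> R) :
  setI_closed (pm_open p).
Proof.
move=> U V oU oV x [/oU[e e0 eU] /oV[d d0 dV]].
exists (Num.min e d); first by rewrite lt_min e0.
move=> y xy; split; [apply: eU | apply: dV];
  by apply: (lt_le_trans xy); rewrite lerD2r ge_min lexx ?orbT.
Qed.

Lemma pm_open_bigU (R : realType) (X : Type) (p : X -> X -> R)
    (I : Type) (F : I -> set X) :
  (forall i, pm_open p (F i)) -> pm_open p (\bigcup_i F i).
Proof.
move=> oF x [i _ /oF[e e0 eF]].
by exists e => // y /eF Fy; exists i.
Qed.

(* The carrier X equipped with the topology tau_p. *)
Definition pm_space (R : realType) (X : Type) (p : X -> X -> R) : Type := X.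

HB.instance Definition _ (R : realType) (X : Type) (p : X -> X -> R) :=
  gen_eqMixin (pm_space p).
HB.instance Definition _ (R : realType) (X : Type) (p : X -> X -> R) :=
  gen_choiceMixin (pm_space p).
HB.instance Definition _ (R : realType) (X : Type) (p : X -> X -> R) :=
  isOpenTopological.Build (pm_space p)
    (pm_openT p) (@pm_openI R X p) (@pm_open_bigU R X p).

Definition pm_hausdorff (R : realType) (X : Type) (p : X -> X -> R) : Prop :=
  hausdorff_space (pm_space p).

Definition pm_cvg (R : realType) (X : Type) (p : X -> X -> R)
  (u : nat -> X) (x : X) : Prop := p (u n) x @[n --> \oo] --> p x x.

Definition pm_cauchy (R : realType) (X : Type) (p : X -> X -> R)
  (u : nat -> X) : Prop :=
  exists l : R, p (u nm.1) (u nm.2) @[nm --> (\oo, \oo)] --> l.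

Definition pm_complete (R : realType) (X : Type) (p : X -> X -> R) : Prop :=
  forall u : nat -> X, pm_cauchy p u ->
    exists x : X, p (u nm.1) (u nm.2) @[nm --> (\oo, \oo)] --> p x x /\
                  p (u n) x @[n --> \oo] --> p x x.

Definition pm_seq_continuous (R : realType) (X : Type) (p : X -> X -> R)
  (f : X -> X) : Prop :=
  forall (u : nat -> X) (x : X), pm_cvg p u x -> pm_cvg p (f \o u) (f x).

Record admissible (R : realType) (X : Type) (K : R) (alpha beta : X -> X -> R)
    (Ca Cb : R) (f : X -> X) : Prop := Admissible {
  admissible_C1 : forall x y, Ca <= alpha x y -> Ca <= alpha (f x) (f y) ;
  admissible_C2 : forall x y, beta x y <= Cb -> beta (f x) (f y) <= Cb ;
  admissible_C3 : 0 <= Cb / Ca < 1 / K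
}.

(* Main.v *)
Require Import Defs.
From HB Require Import structures.
From mathcomp Require Import all_boot all_order all_algebra.
From mathcomp Require Import all_classical all_reals all_analysis.
From mathcomp Require Import ring lra.
Import Order.TTheory GRing.Theory Num.Theory numFieldNormedType.Exports.
Local Open Scope classical_set_scope.
Local Open Scope ring_scope.

(** The fixed point is the limit of the Picard orbit [x_n = f^n x_0].
Admissibility propagates [Ca <= alpha] and [beta <= Cb] along the orbit, so
the contraction inequality makes consecutive distances decay geometrically
with ratio [c = Cb / Ca] ([orbit_geometric]).  The polygonal inequality pm4,
applied with all intermediate points but the first collapsed onto the end
point, gives [p x y <= K * (p x z + p z y + (N - 1) * p y y)]
([pm_triangle]).  Each use of it costs a factor [K] and advances one step
along the orbit, which gains a factor [c]; since [K * c < 1] this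
sums to [p x_n x_(n+k) <= M * c ^+ n] uniformly in [k] ([pm_geometric_tail]).
Hence the orbit is Cauchy and converges to some [x] by completeness.  By
sequential continuity the shifted orbit converges both to [x] and to [f x],
and these agree because p-convergence implies convergence in the Hausdorff
topology generated by [p] ([pm_cvg_unique]). *)

(** An open set contains a ball centred at each of its points, in particular
at the limit, and p-convergence makes the sequence eventually enter every
ball centred at the limit. *)
Lemma pm_cvg_topology {R : realType} {X : Type} {p : X -> X -> R}
    (hsym : forall x y, p x y = p y x) {u : nat -> X} {x : X} :
  pm_cvg p u x -> (u : nat -> pm_space p) @ \oo --> (x : pm_space p).
Proof.
move=> ux A; rewrite nbhsE => -[U [oU Ux] UA].
have [e e0 eU] : exists2 e : R, 0 < e & pm_ball p x e `<=` U by exact: oU.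
have := cvgr_lt _ ux (e + p x x).
rewrite ltrDr => /(_ _ e0); apply: filterS => n pn.
by apply/UA/eU; rewrite /pm_ball /= hsym.
Qed.

Lemma pm_cvg_unique {R : realType} {X : Type} {p : X -> X -> R}
    (hsym : forall x y, p x y = p y x) (hT2 : pm_hausdorff p)
    {u : nat -> X} {x y : X} :
  pm_cvg p u x -> pm_cvg p u y -> x = y.
Proof.
by move=> /(pm_cvg_topology hsym) ux /(pm_cvg_topology hsym); apply: cvg_unique.
Qed.

(** Filling the remaining [N - 1] slots of pm4 with copies of the end point
turns it into a triangle inequality; the resulting self-distances of [y] do
not cancel when [K > 1], but they are harmless as [p y y] is at most any
distance to [y]. *)
Lemma pm_triangle {R : realType} {X : Type} {N : nat} {K : R}
    {p : X -> X -> R} (hp : partial_metric_type N K p) (x y z : X) :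
  p x y <= K * (p x z + p z y + p y y *+ N.-1).
Proof.
case: N hp => [|N] hp; first by have := pm_N_ge1 hp.
have sz : size (z :: nseq N y) == N.+1 by rewrite /= size_nseq.
have := pm4 hp x y (Tuple sz).
have sumy n : \sum_(d <- pairmap p y (nseq n y)) d = p y y *+ n.
  by elim: n => [|n IH] /=; rewrite ?big_nil // big_cons IH mulrS.
have -> : rcons (Tuple sz) y = z :: y :: nseq N y.
  by rewrite /=; congr cons; elim: N {hp sz} => //= n ->.
rewrite /= !big_cons sumy !addrA; apply: le_trans.
by rewrite -addrA lerDl addr_ge0 ?sumr_ge0 // => *; apply: pm_ge0 hp _ _.
Qed.

(** The constant [K * N * D / (1 - K * c)] is the fixed point of
[M |-> K * (N * D + c * M)], which is how a bound [M] for the tail from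
[n + 1] propagates to the tail from [n]: in [pm_triangle] with [u n.+1] as
middle point, the first step and the [N - 1] self-distances of the end point
contribute at most [D * c ^+ n] each. *)
Lemma pm_geometric_tail {R : realType} {X : Type} {N : nat} {K : R}
    {p : X -> X -> R} (hp : partial_metric_type N K p)
    {u : nat -> X} {c D : R} :
    0 <= c -> K * c < 1 -> (forall n, p (u n) (u n.+1) <= D * c ^+ n) ->
  forall k n, p (u n) (u (n + k)%N) <= K * N%:R * D / (1 - K * c) * c ^+ n.
Proof.
move=> c0 Kc1 hu.
have K1 := pm_K_ge1 hp; have N1 := pm_N_ge1 hp.
have c1 : c <= 1 by nra.
have D0 : 0 <= D.
  by apply: le_trans (pm_ge0 hp (u 0%N) (u 1%N)) _; have := hu 0%N; rewrite mulr1.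
have self n : p (u n) (u n) <= D * c ^+ n by apply: le_trans (pm2 hp _ _) (hu n).
set M := _ / _.
have ME : K * (N%:R * D + c * M) = M by rewrite /M; field; rewrite gt_eqF // subr_gt0.
have N1r : 1 <= N%:R :> R by rewrite ler1n.
have KND : D <= K * N%:R * D.
  by rewrite ler_peMl // -[leLHS]mulr1 ler_pM.
have DM : D <= M.
  rewrite /M ler_pdivlMr ?subr_gt0 //; apply: le_trans KND.
  by rewrite ler_piMr // gerBl mulr_ge0 // (le_trans ler01).
elim=> [|k IH] n.
  (* A self-distance is bounded by the next step through pm2. *)
  by rewrite addn0; apply: le_trans (self n) _; rewrite ler_wpM2r ?exprn_ge0.
apply: le_trans (pm_triangle hp _ _ (u n.+1)) _.
rewrite -ME -mulrA ler_wpM2l ?(le_trans ler01) //.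
have step : p (u n.+1) (u (n + k.+1)%N) <= M * c ^+ n.+1 by rewrite -addSnnS.
have far : p (u (n + k.+1)%N) (u (n + k.+1)%N) <= D * c ^+ n.
  by apply: le_trans (self _) _; rewrite ler_wpM2l // ler_wiXn2l // leq_addr.
have {}far : p (u (n + k.+1)%N) (u (n + k.+1)%N) *+ N.-1 <= D * c ^+ n *+ N.-1.
  by rewrite lerMn2r far orbT.
apply: le_trans (lerD (lerD (hu n) step) far) _.
rewrite -[in leRHS](prednK N1) -[D * c ^+ n *+ _]mulr_natl -natr1 exprS.
by rewrite le_eqVlt; apply/orP; left; apply/eqP; ring.
Qed.

(** The tail bound is uniform in the later index, so by symmetry the double
sequence of distances tends to 0 once its smaller index is large. *)
Lemma pm_cauchy_geometric {R : realType} {X : Type} {N : nat} {K : R}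
    {p : X -> X -> R} (hp : partial_metric_type N K p)
    {u : nat -> X} {c D : R} :
    0 <= c -> K * c < 1 -> (forall n, p (u n) (u n.+1) <= D * c ^+ n) ->
  pm_cauchy p u.
Proof.
move=> c0 Kc1 hu; exists 0; apply/cvgrPdist_lt => e e0.
have tail := pm_geometric_tail hp c0 Kc1 hu.
move: tail; set M := _ / _ => tail.
have c1 : `|c| < 1 by rewrite ger0_norm //; have := pm_K_ge1 hp; nra.
have small : \forall n \near \oo, M * c ^+ n < e.
  exact: cvgr_lt (cvg_geometric M c1) _ e0.
exists ([set n | M * c ^+ n < e], [set n | M * c ^+ n < e]); first by split.
move=> [n m] /= [ne me].
rewrite sub0r normrN ger0_norm ?(pm_ge0 hp) //.
wlog le_nm : n m ne me / (n <= m)%N => [wl|].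
  by have [|/ltnW] := leqP n m => ?; last rewrite (pm3 hp); apply: wl.
by rewrite -(subnKC le_nm); apply: le_lt_trans (tail _ _) ne.
Qed.

Lemma orbit_geometric {R : realType} {X : Type} {K : R}
    {p alpha beta : X -> X -> R} {Ca Cb : R} {f : X -> X} (x0 : X)
    (p0 : forall x y, 0 <= p x y) (hCa : 0 < Ca) (hCb : 0 <= Cb)
    (hf : admissible K alpha beta Ca Cb f)
    (hcontr : forall x y, alpha x y * p (f x) (f y) <= beta x y * p x y)
    (ha : Ca <= alpha x0 (f x0)) (hb : beta x0 (f x0) <= Cb) (n : nat) :
  p (iter n f x0) (iter n.+1 f x0) <= p x0 (f x0) * (Cb / Ca) ^+ n.
Proof.
have an k : Ca <= alpha (iter k f x0) (iter k.+1 f x0).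
  by elim: k => [//|k]; apply: (admissible_C1 hf).
have bn k : beta (iter k f x0) (iter k.+1 f x0) <= Cb.
  by elim: k => [//|k]; apply: (admissible_C2 hf).
elim: n => [|n IH]; first by rewrite expr0 mulr1.
have c0 : 0 <= Cb / Ca by rewrite divr_ge0 // ltW.
rewrite exprSr mulrA; apply: le_trans (ler_wpM2r c0 IH).
rewrite mulrA ler_pdivlMr // mulrC [leRHS]mulrC.
apply: le_trans (ler_wpM2r (p0 _ _) (an n)) _.
by apply: le_trans (hcontr _ _) _; apply: ler_wpM2r.
Qed.

Theorem theorem3p3 (R : realType) (X : Type) (N : nat) (K : R)
    (p : X -> X -> R)
    (hp : partial_metric_type N K p)
    (hT2 : pm_hausdorff p)
    (hcomplete : pm_complete p)
    (alpha beta : X -> X -> R)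
    (halpha : forall x y, 0 <= alpha x y)
    (hbeta : forall x y, 0 <= beta x y)
    (Ca Cb : R) (hCa : 0 < Ca) (hCb : 0 <= Cb)
    (f : X -> X)
    (hf : admissible K alpha beta Ca Cb f)
    (hcontr : forall x y, alpha x y * p (f x) (f y) <= beta x y * p x y)
    (hcont : pm_seq_continuous p f)
    (hx0 : exists x0 : X, Ca <= alpha x0 (f x0) /\ beta x0 (f x0) <= Cb) :
  exists x : X, f x = x.
Proof.
have [x0 [ha hb]] := hx0.
have decay := orbit_geometric x0 (pm_ge0 hp) hCa hCb hf hcontr ha hb.
have /andP[c0 cK] := admissible_C3 hf.
have Kc1 : K * (Cb / Ca) < 1.
  by rewrite mulrC -ltr_pdivlMr // (lt_le_trans ltr01 (pm_K_ge1 hp)).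
have [x [_ ux]] := hcomplete _ (pm_cauchy_geometric hp c0 Kc1 decay).
exists x; apply: (pm_cvg_unique (pm3 hp) hT2 (hcont _ _ ux)).
(* [f \o u] is the orbit shifted by one, hence has the same limit. *)
by move: ux; rewrite /pm_cvg -(cvg_shiftS (fun n => p (iter n f x0) x)).
Qed.
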